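(* For every positive integer $n$: (a) $\mathcal{J}_{10}(2n)$ and $\mathcal{J}_{10}(8n+3)$ are even; (b) for each $i\in\{0,1,2\}$, $\mathcal{J}^*_{10}(4n+i)$ is even.
   Context: Let $q=e^{2\pi i\tau}$, $(a;q)_\infty=\prod_{j\ge0}(1-aq^j)$, and $\eta(\tau)=q^{1/24}(q;q)_\infty$. Define $$j_{10}(\tau)=\frac{\eta(2\tau)\eta(5\tau)^5}{\eta(\tau)\eta(10\tau)^5}-1=\frac1q+\sum_{n\ge0}\mathcal{J}_{10}(n)q^n,$$ $$j_{10}^{*}(\tau)=\left(\frac{\eta(\tau)\eta(5\tau)}{\eta(2\tau)\eta(10\tau)}\right)^{4}+4+2^4\left(\frac{\eta(2\tau)\eta(10\tau)}{\eta(\tau)\eta(5\tau)}\right)^{4}=\frac1q+\sum_{n\ge0}\mathcal{J}^*_{10}(n)q^n.$$ *)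

(* Defs.v *)
From mathcomp Require Import all_boot all_order all_algebra.
Set Implicit Arguments. Unset Strict Implicit. Unset Printing Implicit Defensive.
Import GRing.Theory Num.Theory.
Local Open Scope ring_scope.

(* Truncation of (q^k;q^k)_oo = prod_{j>=1} (1 - q^(k j)) to the factors j <= N.
   For k >= 1 and N >= m, its coefficient of q^m equals that of the infinite product. *)
Definition poch_trunc (k N : nat) : {poly int} :=
  \prod_(1 <= j < N.+1) (1 - 'X^(k * j)).

(* Truncation of 1/(q^k;q^k)_oo = prod_{j>=1} sum_{i>=0} q^(k j i) to j <= N, i <= N.
   For k >= 1 and N >= m, its coefficient of q^m equals that of the infinite series. *)
Definition poch_inv_trunc (k N : nat) : {poly int} :=
  \prod_(1 <= j < N.+1) \sum_(i < N.+1) 'X^(k * j * i).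

(* coefficient of q^m in (q^2;q^2)(q^5;q^5)^5 / ((q;q)(q^10;q^10)^5),
   i.e. q * (eta(2t) eta(5t)^5 / (eta(t) eta(10t)^5)) *)
Definition F10_coef (m : nat) : int :=
  (poch_trunc 2 m * poch_trunc 5 m ^+ 5 * poch_inv_trunc 1 m
     * poch_inv_trunc 10 m ^+ 5)`_m.

(* coefficient of q^m in G = ((q;q)(q^5;q^5)/((q^2;q^2)(q^10;q^10)))^4,
   i.e. q * (eta(t)eta(5t)/(eta(2t)eta(10t)))^4 *)
Definition G_coef (m : nat) : int :=
  ((poch_trunc 1 m * poch_trunc 5 m * poch_inv_trunc 2 m
     * poch_inv_trunc 10 m) ^+ 4)`_m.

(* coefficient of q^m in 1/G = ((q^2;q^2)(q^10;q^10)/((q;q)(q^5;q^5)))^4,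
   i.e. q^(-1) * (eta(2t)eta(10t)/(eta(t)eta(5t)))^4 *)
Definition Ginv_coef (m : nat) : int :=
  ((poch_trunc 2 m * poch_trunc 10 m * poch_inv_trunc 1 m
     * poch_inv_trunc 5 m) ^+ 4)`_m.

(* j10 = 1/q + sum_{n>=0} J10 n q^n  (j10 = q^{-1} F - 1) *)
Definition J10 (n : nat) : int :=
  F10_coef n.+1 - (n == 0%N)%:R.

(* j10* = q^{-1} G + 4 + 16 q G^{-1} = 1/q + sum_{n>=0} J10star n q^n *)
Definition J10star (n : nat) : int :=
  G_coef n.+1 + 4 * (n == 0%N)%:R
  + 16 * (if n is n'.+1 then Ginv_coef n' else 0).

(* Main.v *)
Require Import Defs.
From mathcomp Require Import all_boot all_order all_algebra zify ring.
Set Implicit Arguments. Unset Strict Implicit. Unset Printing Implicit Defensive.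
Import GRing.Theory Num.Theory.
Local Open Scope ring_scope.

(* Write P_k = (q^k; q^k)_oo.  Everything rests on the congruence
     P_1 P_5 = P_2^3 + q P_10^3   (mod 2),
   together with P_k^2 = P_2k (mod 2).  For j10 it gives
     P_2 P_5^5 / (P_1 P_10^5) = P_1 P_5 / P_10^3 = q + P_2^3 / P_10^3,
   whose only odd power of q is q itself, and the even part is treated by
     P_1^3 / P_5^3 = (P_1 P_5) P_2 P_10 / P_10^3 = P_8 / P_20 + q P_2 P_10.
   For j10* one has (P_1 P_5 / (P_2 P_10))^4 = P_4 P_20 / (P_8 P_40), a series in q^4.
   The congruence is the reduction of Ramanujan's identity
     psi(q)^2 - q psi(q^5)^2 = f(q, q^4) f(q^2, q^3),   psi(q) = f(q, q^3),
   where the triple product turns f(q, q^4) f(q^2, q^3) into P_1 P_5 and psi(q) into P_1^3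
   modulo 2.  It is proved by counting lattice points on x^2 + y^2 = 8 N + 2 with x, y odd:
   each orbit of the quarter-turn has one representative with x = y = 3 mod 4; if
   x <> 2 y mod 5 it also has exactly one with x - 2 y = 1 mod 5, and the remaining orbits
   are the multiples of 2 + i, which account for q psi(q^5)^2. *)

(** * Gaussian binomials and the finite q-binomial theorem *)

Section QBinomial.

Variables (R : comNzRingType) (Q : R).

Definition qpoch (n : nat) : R := \prod_(1 <= i < n.+1) (1 - Q ^+ i).

Lemma qpochS n : qpoch n.+1 = qpoch n * (1 - Q ^+ n.+1).
Proof. by rewrite /qpoch big_nat_recr. Qed.

Lemma qpoch0 : qpoch 0 = 1.
Proof. by rewrite /qpoch big_geq. Qed.

(** A Pascal recurrence avoids division in [R]. When [m' < j'] the truncated exponent is harmless,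
    since [qbin m' j'] is then 0. *)
Fixpoint qbin (m j : nat) : R :=
  match j, m with
  | 0, _ => 1
  | _.+1, 0 => 0
  | j'.+1, m'.+1 => qbin m' j + Q ^+ (m' - j') * qbin m' j'
  end.

Arguments qbin : simpl never.

Lemma qbinS m j : qbin m.+1 j.+1 = qbin m j.+1 + Q ^+ (m - j) * qbin m j.
Proof. by []. Qed.

Lemma qbin0 m : qbin m 0 = 1.
Proof. by case: m. Qed.

Lemma qbin_small m j : (m < j)%N -> qbin m j = 0.
Proof.
elim: m j => [|m IHm] [|j] //; rewrite ltnS => mj.
by rewrite qbinS !IHm ?mulr0 ?addr0 // ltnW.
Qed.

Lemma qbinn m : qbin m m = 1.
Proof.
elim: m => [|m IHm]; first exact: qbin0.
by rewrite qbinS qbin_small // IHm subnn mulr1 add0r.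
Qed.

Lemma qbin_qpoch m j :
  (j <= m)%N -> qbin m j * qpoch j * qpoch (m - j) = qpoch m.
Proof.
elim: m j => [|m IHm] [|j] //; rewrite ?qbin0 ?subn0 ?qpoch0 ?mul1r //.
rewrite ltnS leq_eqVlt => /orP[/eqP-> | lt_jm].
  by rewrite subnn qpoch0 qbinn mulr1 mul1r.
have IH1 := IHm j.+1 lt_jm; have IH0 := IHm j (ltnW lt_jm).
rewrite qbinS subSS !qpochS.
have mjE : (m - j = (m - j.+1).+1)%N by lia.
have QE : Q ^+ m.+1 = Q ^+ (m - j) * Q ^+ j.+1 by rewrite -exprD; congr (_ ^+ _); lia.
(* Splits 1 - Q^(m+1) as (1 - Q^(m-j)) + Q^(m-j) (1 - Q^(j+1)). *)
transitivity (qbin m j.+1 * qpoch j.+1 * qpoch (m - j.+1) * (1 - Q ^+ (m - j))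
  + Q ^+ (m - j) * (1 - Q ^+ j.+1) * (qbin m j * qpoch j * qpoch (m - j))).
  by rewrite mjE !qpochS; ring.
by rewrite IH1 IH0 QE; ring.
Qed.

(** The form homogeneous in [x] and [y] lets a high power of q for [x] stand in for negative powers
    of q in the bilateral product. *)
Lemma qbinomial_theorem (x y : R) m :
  \prod_(i < m) (x + y * Q ^+ i) =
  \sum_(j < m.+1) qbin m j * Q ^+ 'C(j, 2) * x ^+ (m - j) * y ^+ j.
Proof.
elim: m => [|m IHm]; first by rewrite big_ord0 big_ord1 /= !expr0 !mulr1.
rewrite big_ord_recr /= IHm mulrDr !big_distrl /=.
rewrite big_ord_recl /= [in RHS]big_ord_recl /= !qbin0.
have -> : \sum_(i < m.+1) qbin m.+1 (bump 0 i) * Q ^+ 'C(bump 0 i, 2)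
      * x ^+ (m.+1 - bump 0 i) * y ^+ bump 0 i
   = \sum_(i < m.+1) qbin m i.+1 * Q ^+ 'C(i.+1, 2) * x ^+ (m - i) * y ^+ i.+1
   + \sum_(i < m.+1) Q ^+ (m - i) * qbin m i * Q ^+ 'C(i.+1, 2)
        * x ^+ (m - i) * y ^+ i.+1.
  by rewrite -big_split; apply: eq_bigr => i _; rewrite /= /bump leq0n add1n qbinS subSS; ring.
rewrite [X in _ = _ + (X + _)]big_ord_recr /= (@qbin_small m m.+1) //.
rewrite !mul0r addr0 !addrA; congr (_ + _ + _).
- by rewrite !subn0 exprS; ring.
- apply: eq_bigr => i _; rewrite /bump /= !add1n.
  have -> : (m - i = (m - i.+1).+1)%N by have := ltn_ord i; lia.
  by rewrite [x ^+ _.+1]exprS; ring.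
- apply: eq_bigr => i _.
  have -> : Q ^+ m = Q ^+ (m - i) * Q ^+ i.
    by rewrite -exprD subnK // -ltnS.
  by rewrite binS bin1 exprD [y ^+ _.+1]exprS; ring.
Qed.

End QBinomial.

(** * Congruence modulo a power of ['X], standing for equality of truncated power series *)

Section TruncatedCongruence.

Variable F : fieldType.
Implicit Types c p q r s : {poly F}.

Definition eqX (M : nat) p q : bool := 'X^M %| p - q.

Lemma eqXP M p q : eqX M p q -> exists r, p = q + 'X^M * r.
Proof. by case/dvdpP=> r E; exists r; rewrite ['X^M * r]mulrC -E; ring. Qed.

Lemma eqX_refl M p : eqX M p p.
Proof. by rewrite /eqX subrr dvdp0. Qed.

Lemma eqX_sym M p q : eqX M p q -> eqX M q p.
Proof. by rewrite /eqX -(opprB q p) dvdpNr. Qed.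

Lemma eqX_trans M q p r : eqX M p q -> eqX M q r -> eqX M p r.
Proof. by move=> pq qr; rewrite /eqX -(subrK q p) -addrA dvdp_add. Qed.

Lemma eqXD M p q r s : eqX M p q -> eqX M r s -> eqX M (p + r) (q + s).
Proof.
by move=> pq rs; rewrite /eqX opprD addrACA dvdp_add.
Qed.

Lemma eqXM M p q r s : eqX M p q -> eqX M r s -> eqX M (p * r) (q * s).
Proof.
move=> pq rs; rewrite /eqX.
have -> : p * r - q * s = (p - q) * r + q * (r - s) by ring.
by apply: dvdp_add; [apply: dvdp_mulr | apply: dvdp_mull].
Qed.

Lemma eqXMl M p q r : eqX M q r -> eqX M (p * q) (p * r).
Proof. exact: eqXM (eqX_refl M p). Qed.

Lemma eqXMr M p q r : eqX M q r -> eqX M (q * p) (r * p).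
Proof. by move/eqXM; apply; apply: eqX_refl. Qed.

Lemma eqXX M p q n : eqX M p q -> eqX M (p ^+ n) (q ^+ n).
Proof.
move=> pq; elim: n => [|n IHn]; first by rewrite !expr0 eqX_refl.
by rewrite !exprS eqXM.
Qed.

Lemma eqX_sum M (I : Type) (r : seq I) (P : pred I) (f g : I -> {poly F}) :
  (forall i, P i -> eqX M (f i) (g i)) ->
  eqX M (\sum_(i <- r | P i) f i) (\sum_(i <- r | P i) g i).
Proof.
move=> fg; apply: (big_ind2 (eqX M)) => //; first exact: eqX_refl.
by move=> *; apply: eqXD.
Qed.

Lemma eqX_prod M (I : Type) (r : seq I) (P : pred I) (f g : I -> {poly F}) :
  (forall i, P i -> eqX M (f i) (g i)) ->
  eqX M (\prod_(i <- r | P i) f i) (\prod_(i <- r | P i) g i).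
Proof.
move=> fg; apply: (big_ind2 (eqX M)) => //; first exact: eqX_refl.
by move=> *; apply: eqXM.
Qed.

Lemma eqXW M N p q : (M <= N)%N -> eqX N p q -> eqX M p q.
Proof. by move=> MN; apply: dvdp_trans; rewrite dvdp_exp2l. Qed.

Lemma eqXn0 M n : (M <= n)%N -> eqX M 'X^n 0.
Proof. by move=> Mn; rewrite /eqX subr0 dvdp_exp2l. Qed.

Lemma coef_eqX M p q i : eqX M p q -> (i < M)%N -> p`_i = q`_i.
Proof. by move=> /eqXP[r ->] iM; rewrite coefD coefXnM iM addr0. Qed.

(** A nonzero constant term makes [c] coprime to ['X]. *)
Lemma eqX_cancel M c p q : c`_0 != 0 -> eqX M (c * p) (c * q) -> eqX M p q.
Proof.
move=> c0; rewrite /eqX -mulrBr Gauss_dvdpr //.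
by rewrite coprimep_sym coprimep_expr // coprimepX /root horner_coef0.
Qed.

End TruncatedCongruence.

(** * A truncated Jacobi triple product *)

Section TripleProduct.

Variable F : fieldType.

Definition euler (k N : nat) : {poly F} := \prod_(1 <= j < N.+1) (1 - 'X^(k * j)).

Lemma eulerE k N : euler k N = qpoch 'X^k N.
Proof. by apply: eq_bigr => j _; rewrite exprM. Qed.

Lemma euler_coef0 k N : (0 < k)%N -> (euler k N)`_0 = 1.
Proof.
move=> k0; rewrite -horner_coef0 horner_prod big_nat big1 // => j /andP[j0 _].
by rewrite !hornerE expr0n muln_eq0 !gtn_eqF // subr0.
Qed.

Lemma euler_coef0_neq0 k N n : (0 < k)%N -> (euler k N ^+ n)`_0 != 0.
Proof.
by move=> k0; rewrite -horner_coef0 hornerE horner_coef0 euler_coef0 // expr1n oner_neq0.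
Qed.

Lemma euler_eqX k d N : (d <= N)%N -> eqX (k * d.+1) (euler k N) (euler k d).
Proof.
move=> dN; rewrite /euler (@big_cat_nat _ _ _ d.+1) //= -[X in eqX _ _ X]mulr1; apply: eqXMl.
have E : \prod_(d.+1 <= i < N.+1) 1 = 1 :> {poly F} by rewrite big1_eq.
rewrite -[X in eqX _ _ X]E {E}.
rewrite big_nat [X in eqX _ _ X]big_nat.
apply: eqX_prod => i /andP[di _]; rewrite -[X in eqX _ _ X]subr0.
apply: eqXD (eqX_refl _ _) _; rewrite -!scaleN1r -!mul_polyC.
by apply: eqXMl; rewrite eqXn0 // leq_mul2l di orbT.
Qed.

(** The middle Gaussian binomials tend to 1/(q^c; q^c)_oo, with precision set by the distance from
    [j] to the nearer end. To that precision all Euler products in [qbin_qpoch] agree with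
    [euler c d], which cancels. *)
Lemma qbin_limit c L j : (0 < c)%N -> (j <= 2 * L)%N ->
  eqX (c * (minn j (2 * L - j)).+1) (qbin 'X^c (2 * L) j * euler c L) 1.
Proof.
move=> c0 jL; set d := minn _ _.
have [dj dj' dL] : [/\ (d <= j)%N, (d <= 2 * L - j)%N & (d <= L)%N] by rewrite /d; split; lia.
have := qbin_qpoch ('X^c : {poly F}) jL; rewrite -!eulerE => E.
apply: (@eqX_cancel _ _ (euler c d)); first by rewrite euler_coef0 // oner_neq0.
rewrite mulr1; apply: eqX_trans (euler_eqX c (_ : d <= 2 * L)%N); last by lia.
rewrite -E mulrC -!mulrA; apply: eqXMl.
apply: eqXM; last by apply: eqX_sym; apply: euler_eqX.
by apply: (eqX_trans (euler_eqX c dL)); apply: eqX_sym; apply: euler_eqX.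
Qed.

(* c n (n - 1) / 2 + a n; the absolute value is harmless for a <= c, see theta_expE. *)
Definition theta_exp (c a : nat) (n : int) : nat :=
  absz (((c%:Z * (n * (n - 1))) %/ 2)%Z + a%:Z * n).

Lemma theta_expE c a n : (a <= c)%N ->
  2 * (theta_exp c a n)%:Z = c%:Z * (n * (n - 1)) + 2 * a%:Z * n.
Proof.
move=> ac; rewrite /theta_exp.
have [t tE] : exists t : int, n * (n - 1) = 2 * t.
  have [m [->|->]] : exists m : int, n = 2 * m \/ n = 2 * m + 1.
    by exists (n %/ 2)%Z; lia.
    by exists (m * (2 * m - 1)); ring.
  by exists (m * (2 * m + 1)); ring.
have -> : c%:Z * (n * (n - 1)) = (c%:Z * t) * 2 by rewrite tE; ring.
rewrite mulzK // gez0_abs; first by ring.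
have : 0 <= 2 * (c%:Z * t + a%:Z * n).
  have -> : 2 * (c%:Z * t + a%:Z * n) = c%:Z * (n * (n - 1)) + 2 * a%:Z * n.
    by rewrite tE; ring.
  have [n0|n0] : 1 <= n \/ n <= 0 by lia.
    nia.
  (* For n <= 0 the form equals c n (n + 1) + 2 (c - a) (- n). *)
  have : 0 <= (c%:Z - a%:Z) * - n by apply: mulr_ge0; lia.
  have : 0 <= c%:Z * (n * (n + 1)).
    apply: mulr_ge0; first by lia.
    nia.
  nia.
lia.
Qed.

(** Bounds the index by the exponent; this controls truncation errors and keeps solutions inside the
    lattice box. *)
Lemma theta_exp_ge c a n : (0 < a < c)%N -> `|n| <= (theta_exp c a n)%:Z.
Proof.
case/andP=> a0 ac; have := theta_expE n (ltnW ac).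
have [n0|n0] : 1 <= n \/ n <= 0 by lia.
  have : 0 <= c%:Z * (n * (n - 1)) by apply: mulr_ge0; nia.
  have : 0 <= (a%:Z - 1) * n by apply: mulr_ge0; lia.
  lia.
have : 0 <= c%:Z * (n * (n + 1)) by apply: mulr_ge0; nia.
have : 0 <= (c%:Z - a%:Z - 1) * - n by apply: mulr_ge0; lia.
lia.
Qed.

(** Truncation to |n| <= L of Ramanujan's f(q^a, q^(c-a)), with j = n + L. *)
Definition theta (c a L : nat) : {poly F} :=
  \sum_(j < (2 * L).+1) 'X^(theta_exp c a (j%:Z - L%:Z)).

Definition arith_prod (c a L : nat) : {poly F} := \prod_(k < L) (1 + 'X^(c * k + a)).

(** Each factor gives up the lower of its two powers: ['X^(a + c * i)] for i < L, and ['X^(c * L)]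
    beyond. *)
Lemma arith_prod_split c a L : (a <= c)%N ->
  \prod_(i < 2 * L) ('X^(c * L) + 'X^a * 'X^c ^+ i) =
  'X^(a * L + c * 'C(L, 2) + c * L * L) * (arith_prod c a L * arith_prod c (c - a) L)
    :> {poly F}.
Proof.
move=> ac; rewrite mul2n -addnn big_split_ord /=.
have -> : \prod_(i < L) ('X^(c * L) + 'X^a * 'X^c ^+ i)
    = 'X^(a * L + c * 'C(L, 2)) * arith_prod c (c - a) L :> {poly F}.
  rewrite /arith_prod [in RHS](reindex_inj rev_ord_inj) /=.
  have <- : (\sum_(i < L) (a + c * i) = a * L + c * 'C(L, 2))%N.
    rewrite big_split /= sum_nat_const card_ord mulnC -big_distrr /=.
    by rewrite -bin2_sum big_mkord.
  rewrite -prodrXr -big_split; apply: eq_bigr => i _ /=.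
  rewrite mulrDr mulr1 -exprM -!exprD addrC; congr (_ + 'X^_).
  have := ltn_ord i; nia.
have -> : \prod_(i < L) ('X^(c * L) + 'X^a * 'X^c ^+ (L + i))
    = 'X^(c * L * L) * arith_prod c a L :> {poly F}.
  have -> : 'X^(c * L * L) = \prod_(i < L) 'X^(c * L) :> {poly F}.
    by rewrite prodr_const card_ord exprM.
  rewrite -big_split; apply: eq_bigr => i _ /=.
  by rewrite mulrDr mulr1 -exprM -!exprD; congr (_ + 'X^_); lia.
by rewrite [in RHS]exprD; ring.
Qed.

Lemma theta_exp_bin c a L j : (a <= c)%N -> (j <= 2 * L)%N ->
  (c * 'C(j, 2) + c * L * (2 * L - j) + a * j =
   a * L + c * 'C(L, 2) + c * L * L + theta_exp c a (j%:Z - L%:Z))%N.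
Proof.
move=> ac jL; have := theta_expE (j%:Z - L%:Z) ac.
have bin2Z n : 2 * ('C(n, 2))%:Z = n%:Z * (n%:Z - 1).
  by have := mul_bin_diag n 1; rewrite bin1; case: n => [|n] /=; lia.
move=> E; apply/eqP; rewrite -eqz_nat; apply/eqP.
apply: (@mulfI _ (2 : int)) => //.
rewrite !(PoszD, PoszM) -subzn // PoszM !mulrDr E.
transitivity (c%:Z * (2 * ('C(j, 2))%:Z)
  + 2 * (c%:Z * L%:Z * (2 * L%:Z - j%:Z)) + 2 * (a%:Z * j%:Z)).
  by ring.
transitivity (2 * (a%:Z * L%:Z) + c%:Z * (2 * ('C(L, 2))%:Z) + 2 * (c%:Z * L%:Z * L%:Z)
  + (c%:Z * ((j%:Z - L%:Z) * (j%:Z - L%:Z - 1)) + 2 * a%:Z * (j%:Z - L%:Z))).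
  by rewrite !bin2Z; ring.
by ring.
Qed.

Lemma eqXMXn m M (p q : {poly F}) : eqX M p q -> eqX (m + M) ('X^m * p) ('X^m * q).
Proof. by rewrite /eqX -mulrBr exprD => ?; rewrite dvdp_mul2l // expf_neq0 ?polyX_eq0. Qed.

(** After a common power of ['X] is cancelled in the q-binomial theorem, [euler c L] turns each
    Gaussian binomial into 1 up to the truncation order. *)
Lemma triple_product c a L M : (0 < a < c)%N -> (2 * M <= L)%N ->
  eqX M (arith_prod c a L * arith_prod c (c - a) L * euler c L) (theta c a L).
Proof.
move=> /andP[a0 ac] ML.
have := qbinomial_theorem 'X^c ('X^(c * L) : {poly F}) 'X^a (2 * L).
rewrite arith_prod_split ?(ltnW ac) //.
have -> : \sum_(j < (2 * L).+1) qbin 'X^c (2 * L) j * 'X^c ^+ 'C(j, 2)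
      * 'X^(c * L) ^+ (2 * L - j) * 'X^a ^+ j
    = 'X^(a * L + c * 'C(L, 2) + c * L * L) * \sum_(j < (2 * L).+1)
        qbin 'X^c (2 * L) j * 'X^(theta_exp c a (j%:Z - L%:Z)) :> {poly F}.
  rewrite mulr_sumr; apply: eq_bigr => j _.
  rewrite -!exprM -!mulrA -!exprD [RHS]mulrCA -exprD; congr (_ * 'X^_).
  by rewrite -theta_exp_bin ?(ltnW ac) ?addnA // -ltnS.
move/mulfI => -> //; last by rewrite expf_neq0 ?polyX_eq0.
rewrite mulr_suml; apply: eqX_sum => j _.
have jL : (j <= 2 * L)%N by rewrite -ltnS.
have := qbin_limit (ltn_trans a0 ac) jL.
move/(eqXMXn (theta_exp c a (j%:Z - L%:Z))); rewrite mulr1 mulrA [_ * qbin _ _ _]mulrC.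
(* With n = j - L the minimum is L - |n| and the theta exponent is at least |n|, so together they
   reach [M]. *)
apply: eqXW; have := @theta_exp_ge c a (j%:Z - L%:Z); rewrite a0 ac => /(_ isT).
nia.
Qed.

End TripleProduct.

(** * Lattice points on x^2 + y^2 = 8 N + 2 *)

Section LatticePoints.

Definition zbox (L : nat) : seq (int * int) :=
  [seq (x%:Z - L%:Z, y%:Z - L%:Z) | x <- iota 0 (2 * L).+1, y <- iota 0 (2 * L).+1].

Definition npts (L : nat) (P : pred (int * int)) : nat := count P (zbox L).

Lemma mem_zbox L p : (p \in zbox L) = (`|p.1| <= L%:Z) && (`|p.2| <= L%:Z).
Proof.
apply/allpairsP/andP=> [[[x y] [xL yL ->]] | []].
  by move: xL yL; rewrite !mem_iota; cbn [fst snd]; split; lia.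
case: p => x y; cbn [fst snd] => xL yL; exists (absz (x + L%:Z), absz (y + L%:Z)).
by rewrite !mem_iota; cbn [fst snd]; split; [lia | lia | congr pair; lia].
Qed.

Lemma zbox_uniq L : uniq (zbox L).
Proof.
apply: allpairs_uniq; rewrite ?iota_uniq // => -[x y] [x' y'] _ _ /= [xx yy].
by congr pair; lia.
Qed.

Lemma npts_bij L (P Q : pred (int * int)) f g :
    (forall p, P p -> [/\ Q (f p), g (f p) = p & p \in zbox L]) ->
    (forall q, Q q -> [/\ P (g q), f (g q) = q & q \in zbox L]) ->
  npts L P = npts L Q.
Proof.
move=> fP gQ; rewrite /npts -!size_filter.
have PQ : perm_eq [seq f p | p <- zbox L & P p] [seq q <- zbox L | Q q].
  apply: uniq_perm.
  - rewrite map_inj_in_uniq ?filter_uniq ?zbox_uniq // => p q.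
    rewrite !mem_filter => /andP[/fP[_ gp _] _] /andP[/fP[_ gq _] _] fpq.
    by rewrite -gp fpq gq.
  - by rewrite filter_uniq ?zbox_uniq.
  move=> q; rewrite mem_filter; apply/mapP/andP=> [[p] | [Qq _]].
    rewrite mem_filter => /andP[/fP[Qf gf pL] _] ->; split=> //.
    by have [] := gQ _ Qf.
  have [Pg fg qL] := gQ _ Qq; exists (g q) => //.
  by rewrite mem_filter Pg; have [] := fP _ Pg.
by rewrite -(perm_size PQ) size_map.
Qed.

Lemma eq_npts_sum L (P : pred (int * int)) (Qs : seq (pred (int * int))) :
  (forall p, P p = \sum_(Q <- Qs) Q p :> nat)%N -> npts L P = (\sum_(Q <- Qs) npts L Q)%N.
Proof.
move=> PQ; rewrite /npts; elim: (zbox L) => [|p s IHs]; first by rewrite big1_eq.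
by rewrite [LHS]/= IHs PQ -big_split.
Qed.

Definition circ (N : nat) : pred (int * int) :=
  [pred p | p.1 * p.1 + p.2 * p.2 == 8 * N%:Z + 2].

Definition circ_class (N : nat) (s t c : int) : pred (int * int) :=
  [pred p | circ N p && [&& (p.1 %% 4)%Z == s, (p.2 %% 4)%Z == t
                          & ((p.1 - 2 * p.2) %% 5)%Z == c]].

Lemma circE N x y : circ N (x, y) = (x * x + y * y == 8 * N%:Z + 2).
Proof. by []. Qed.

Lemma circ_classE N s t c x y : circ_class N s t c (x, y) =
  circ N (x, y) && [&& (x %% 4)%Z == s, (y %% 4)%Z == t & ((x - 2 * y) %% 5)%Z == c].
Proof. by []. Qed.

Lemma circ_zbox N L p : (8 * N + 2 <= L)%N -> circ N p -> p \in zbox L.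
Proof.
case: p => x y NL /eqP /= E; rewrite mem_zbox /=.
have norm_le_sqr (z : int) : `|z| <= z * z.
  by have [?|?] : 0 <= z \/ z <= 0 by [lia]; [rewrite ger0_norm | rewrite ler0_norm]; nia.
have := norm_le_sqr x; have := norm_le_sqr y.
by move=> ? ?; apply/andP; split; lia.
Qed.

(* The rotation (x, y) |-> (- y, x) has order 4 and multiplies x - 2 y by 3 modulo 5. *)
Lemma npts_circ_rot N L (s t c : int) : (8 * N + 2 <= L)%N ->
  0 <= s < 4 -> 0 <= t < 4 -> 0 <= c < 5 ->
  npts L (circ_class N s t c) =
  npts L (circ_class N ((- t) %% 4)%Z s ((3 * c) %% 5)%Z).
Proof.
move=> NL s4 t4 c5.
apply: (@npts_bij _ _ _ (fun p => (- p.2, p.1)) (fun p => (p.2, - p.1))) => -[x y];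
  cbn [fst snd]; rewrite !circ_classE opprK;
  case/andP=> xyN /and3P[/eqP xs /eqP yt /eqP xyc]; split=> //;
  rewrite ?(circ_zbox NL xyN) //; move: xyN; rewrite !circE mulrNN addrC => -> /=;
  by apply/and3P; split; lia.
Qed.

(** The index pairs contributing to the coefficient of q^N in q^d times a product of two theta
    series. *)
Definition theta_pts c a c' a' d N : pred (int * int) :=
  [pred p | d + theta_exp c a p.1 + theta_exp c' a' p.2 == N]%N.

Lemma theta_pts_zbox c a c' a' d N L p : (0 < a < c)%N -> (0 < a' < c')%N -> (N <= L)%N ->
  theta_pts c a c' a' d N p -> p \in zbox L.
Proof.
case: p => x y ac ac' NL /eqP /= E; rewrite mem_zbox /=.
have := theta_exp_ge x ac; have := theta_exp_ge y ac'.
by move=> ? ?; apply/andP; split; lia.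
Qed.

(* Solutions correspond to (10 n - 3)^2 + (10 m - 1)^2 = 5 (8 N + 2); the bijection divides
   (10 n - 3) + (10 m - 1) i by 2 - i. *)
Lemma npts_theta51_theta52 N L : (8 * N + 2 <= L)%N ->
  npts L (theta_pts 5 1 5 2 0 N) =
  npts L [pred p | circ N p && [&& (p.1 %% 2)%Z == 1, (p.2 %% 2)%Z == 1
                          & ((p.1 - 2 * p.2) %% 5)%Z == 1]].
Proof.
move=> NL.
have key n m : theta_pts 5 1 5 2 0 N (n, m) = circ N (4 * n - 2 * m - 1, 2 * n + 4 * m - 1).
  have E1 := @theta_expE 5 1 n isT; have E2 := @theta_expE 5 2 m isT.
  by rewrite circE /theta_pts /=; apply/eqP/eqP; lia.
apply: (@npts_bij _ _ _ (fun p => (4 * p.1 - 2 * p.2 - 1, 2 * p.1 + 4 * p.2 - 1))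
   (fun p => (((2 * p.1 + p.2 + 3) %/ 10)%Z, ((2 * p.2 - p.1 + 1) %/ 10)%Z))) => -[x y] /= Pxy.
  split; last by apply: theta_pts_zbox Pxy => //; lia.
    by rewrite -key Pxy /=; apply/and3P; split; lia.
  by congr pair; lia.
case/andP: Pxy => xyN /and3P[xs yt xyc].
have Exy : (4 * ((2 * x + y + 3) %/ 10)%Z - 2 * ((2 * y - x + 1) %/ 10)%Z - 1,
   2 * ((2 * x + y + 3) %/ 10)%Z + 4 * ((2 * y - x + 1) %/ 10)%Z - 1) = (x, y).
  by congr pair; lia.
by split; [rewrite key Exy | | apply: circ_zbox xyN].
Qed.

(** Here 8 (2 n^2 - n) + 1 = (4 n - 1)^2, and 4 n - 1 runs over the integers that are 3 mod 4. *)
Lemma npts_theta41_sqr N L : (8 * N + 2 <= L)%N ->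
  npts L (theta_pts 4 1 4 1 0 N) =
  npts L [pred p | circ N p && ((p.1 %% 4)%Z == 3) && ((p.2 %% 4)%Z == 3)].
Proof.
move=> NL.
have key n m : theta_pts 4 1 4 1 0 N (n, m) = circ N (4 * n - 1, 4 * m - 1).
  have E1 := @theta_expE 4 1 n isT; have E2 := @theta_expE 4 1 m isT.
  by rewrite circE /theta_pts /=; apply/eqP/eqP; lia.
apply: (@npts_bij _ _ _ (fun p => (4 * p.1 - 1, 4 * p.2 - 1))
   (fun p => (((p.1 + 1) %/ 4)%Z, ((p.2 + 1) %/ 4)%Z))) => -[x y] /= Pxy.
  split; last by apply: theta_pts_zbox Pxy => //; lia.
    by rewrite -key Pxy /=; apply/andP; split; lia.
  by congr pair; lia.
case/andP: Pxy => /andP[xyN xs] yt.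
have Exy : (4 * ((x + 1) %/ 4)%Z - 1, 4 * ((y + 1) %/ 4)%Z - 1) = (x, y).
  by congr pair; lia.
by split; [rewrite key Exy | | apply: circ_zbox xyN].
Qed.

(** With u = 4 n - 1 and v = 4 m - 1 the equation is 5 (u^2 + v^2) = 8 N + 2, and x + i y = (2 + i)
    (- u + i v); these signs make x and y both 3 mod 4. *)
Lemma npts_theta20_sqr N L : (8 * N + 2 <= L)%N ->
  npts L (theta_pts 20 5 20 5 1 N) = npts L (circ_class N 3 3 0).
Proof.
move=> NL.
have key n m : theta_pts 20 5 20 5 1 N (n, m)
    = circ N (3 - 8 * n - 4 * m, 8 * m - 4 * n - 1).
  have E1 := @theta_expE 20 5 n isT; have E2 := @theta_expE 20 5 m isT.
  by rewrite circE /theta_pts /=; apply/eqP/eqP; lia.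
apply: (@npts_bij _ _ _ (fun p => (3 - 8 * p.1 - 4 * p.2, 8 * p.2 - 4 * p.1 - 1))
   (fun p => (((5 - 2 * p.1 - p.2) %/ 20)%Z, ((5 + 2 * p.2 - p.1) %/ 20)%Z))) => -[x y] /= Pxy.
  split; last by apply: theta_pts_zbox Pxy => //; lia.
    by rewrite circ_classE -key Pxy /=; apply/and3P; split; lia.
  by congr pair; lia.
move: Pxy; rewrite circ_classE => /andP[xyN /and3P[/eqP xs /eqP yt /eqP xyc]].
have Exy : (3 - 8 * ((5 - 2 * x - y) %/ 20)%Z - 4 * ((5 + 2 * y - x) %/ 20)%Z,
   8 * ((5 + 2 * y - x) %/ 20)%Z - 4 * ((5 - 2 * x - y) %/ 20)%Z - 1) = (x, y).
  by congr pair; lia.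
by split; [rewrite key Exy | | apply: circ_zbox xyN].
Qed.

(** Ramanujan's identity, coefficient by coefficient. As 3 generates the units modulo 5, exactly one
    quarter-turn brings a given nonzero residue of x - 2 y to 1. *)
Lemma npts_theta N L : (8 * N + 2 <= L)%N ->
  npts L (theta_pts 4 1 4 1 0 N) =
  (npts L (theta_pts 5 1 5 2 0 N) + npts L (theta_pts 20 5 20 5 1 N))%N.
Proof.
move=> NL; rewrite npts_theta51_theta52 // npts_theta41_sqr // npts_theta20_sqr //.
have rot := @npts_circ_rot N L _ _ _ NL.
have mod2E (z : int) : ((z %% 2)%Z == 1) = ((z %% 4)%Z == 1) || ((z %% 4)%Z == 3) by lia.
rewrite (@eq_npts_sum L _ [:: circ_class N 3 3 0; circ_class N 3 3 1; circ_class N 3 3 2;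
   circ_class N 3 3 3; circ_class N 3 3 4]); last first.
  move=> [x y]; rewrite !big_cons big_nil !circ_classE /=.
  case: (circ N _) => //=; case: (_ == 3) => //=; case: (_ == 3) => //=.
  have [] : [/\ 0 <= ((x - 2 * y) %% 5)%Z & ((x - 2 * y) %% 5)%Z < 5] by split; lia.
  by case: (_ %% 5)%Z => [[|[|[|[|[|r]]]]]|r].
rewrite [in RHS](@eq_npts_sum L _ [:: circ_class N 3 3 1; circ_class N 1 3 1;
   circ_class N 1 1 1; circ_class N 3 1 1]); last first.
  move=> [x y]; rewrite !big_cons big_nil !circ_classE /= !mod2E.
  case: (circ N _) => //=; case: (((x - 2 * y) %% 5)%Z == 1); rewrite ?andbF //.
  case: (x %% 4)%Z => [[|[|[|[|r]]]]|r] //; by case: (y %% 4)%Z => [[|[|[|[|r]]]]|r].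
rewrite !big_cons !big_nil !addn0.
(* The residues 2, 4, 3 need one, two and three turns, as 2 * 3, 4 * 9 and 3 * 27 are all 1 mod
   5. *)
have -> : npts L (circ_class N 1 3 1) = npts L (circ_class N 3 3 2).
  by rewrite [RHS]rot.
have -> : npts L (circ_class N 1 1 1) = npts L (circ_class N 3 3 4).
  by rewrite [RHS]rot // [RHS]rot.
have -> : npts L (circ_class N 3 1 1) = npts L (circ_class N 3 3 3).
  by rewrite [RHS]rot // [RHS]rot // [RHS]rot.
lia.
Qed.

End LatticePoints.

(** * Coefficients of theta products, and dissection of products by residue class *)

Lemma eqX_coef (F : fieldType) M (p q : {poly F}) :
  (forall i, (i < M)%N -> p`_i = q`_i) -> eqX M p q.
Proof.
move=> pq; rewrite /eqX -(poly_take_drop M (p - q)) dvdp_addl ?dvdp_mull //.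
suff -> : take_poly M (p - q) = 0 by rewrite dvdp0.
by apply/polyP => i; rewrite coef_take_poly coef0 coefB; case: ifP => // /pq->; rewrite subrr.
Qed.

(** Exact for every [N], because [theta] and [zbox L] are both cut at |n| <= L. *)
Lemma coef_theta_mul (F : fieldType) c a c' a' d L N :
  ('X^d * (theta F c a L * theta F c' a' L))`_N =
  (npts L (theta_pts c a c' a' d N))%:R :> F.
Proof.
have thetaE b e : theta F b e L = \sum_(n <- iota 0 (2 * L).+1) 'X^(theta_exp b e (n%:Z - L%:Z)).
  rewrite /theta -(big_mkord xpredT (fun n => 'X^(theta_exp b e (n%:Z - L%:Z)))).
  by rewrite /index_iota subn0.
rewrite !thetaE /npts -sum1_count natr_sum [RHS]big_mkcond big_allpairs_dep.
rewrite big_distrlr mulr_sumr coef_sum.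
apply: eq_bigr => x _; rewrite mulr_sumr coef_sum; apply: eq_bigr => y _.
by rewrite [LHS]/= -!exprD coefXn addnA [N == _]eq_sym /theta_pts inE; case: (_ == _).
Qed.

Lemma arith_prod_dissect (F : fieldType) k a m L :
  arith_prod F k a (m * L) = \prod_(r < m) arith_prod F (m * k) (k * r + a) L.
Proof.
elim: L => [|L IHL].
  by rewrite muln0 /arith_prod big_ord0 big1 // => r _; rewrite big_ord0.
rewrite mulnS addnC /arith_prod big_split_ord /=.
have := IHL; rewrite /arith_prod => ->.
rewrite -big_split; apply: eq_bigr => r _ /=; rewrite [RHS]big_ord_recr /=.
by congr (_ * (1 + 'X^_)); lia.
Qed.

(** * Euler products modulo 2 and the congruence for P_1 P_5 *)

Local Notation P := (euler [the fieldType of 'F_2]).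

Lemma pchar2_polyF2 : 2 \in [pchar {poly 'F_2}].
Proof. by rewrite pchar_poly pchar_Fp. Qed.

Lemma oppF2 (p : {poly 'F_2}) : - p = p.
Proof. exact: oppr_pchar2 pchar2_polyF2 p. Qed.

Lemma addF2 (p : {poly 'F_2}) : p + p = 0.
Proof. exact: addrr_pchar2 pchar2_polyF2 p. Qed.

Lemma sqrDF2 (p q : {poly 'F_2}) : (p + q) ^+ 2 = p ^+ 2 + q ^+ 2.
Proof. by rewrite sqrrD mulr2n addF2 addr0. Qed.

Lemma euler_arith k N : P k N = arith_prod _ k k N.
Proof.
rewrite /euler big_add1 big_mkord; apply: eq_bigr => i _.
by rewrite oppF2 mulnS addnC.
Qed.

Lemma euler_sqr k N : P k N ^+ 2 = P (2 * k) N.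
Proof.
rewrite /euler -prodrXl; apply: eq_bigr => i _.
by rewrite !oppF2 sqrDF2 expr1n -exprM; congr (_ + 'X^_); lia.
Qed.

Lemma eqX_euler k M N1 N2 : (0 < k)%N -> (M <= N1.+1)%N -> (M <= N2.+1)%N ->
  eqX M (P k N1) (P k N2).
Proof.
move=> k0 MN1 MN2; pose d := minn N1 N2.
have eqd N : (d <= N)%N -> eqX M (P k N) (P k d).
  by move=> dN; apply: (eqXW _ (euler_eqX _ k dN)); rewrite /d; nia.
by apply: (eqX_trans (eqd _ _)); [lia | apply: eqX_sym; apply: eqd; lia].
Qed.

(** This is psi(q^k) = P_k^3 modulo 2. Multiplying the triple product by P_2k gives P_k P_4k =
    P_k^5, and P_2k = P_k^2 cancels. *)
Lemma theta_euler3 k L M : (0 < k)%N -> (2 * M <= L)%N ->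
  eqX M (theta _ (4 * k) k L) (P k L ^+ 3).
Proof.
move=> k0 ML.
have := @triple_product [the fieldType of 'F_2] (4 * k) k L M; rewrite k0 => /(_ _ ML) triple.
have {}triple := triple (ltac:(lia)).
(* [P (2 * k)] supplies the classes 2k and 4k modulo 4k; its 2 L factors give L to each. *)
have E : arith_prod _ (4 * k) k L * arith_prod _ (4 * k) (4 * k - k) L * P (2 * k) (2 * L)
    = P k (4 * L).
  rewrite !euler_arith !arith_prod_dissect !big_ord_recr !big_ord0 /= !mul1r.
  rewrite (_ : (4 * k - k = k * 2 + k)%N); last by lia.
  rewrite (_ : (2 * (2 * k) = 4 * k)%N); last by lia.
  rewrite (_ : (2 * k * 0 + 2 * k = k * 1 + k)%N); last by lia.
  rewrite (_ : (2 * k * 1 + 2 * k = k * 3 + k)%N); last by lia.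
  by rewrite muln0 add0n; ring.
apply: (@eqX_cancel _ _ (P k L ^+ 2)); first exact: euler_coef0_neq0.
apply: (@eqX_trans _ _ (P (2 * k) (2 * L) * theta _ (4 * k) k L)).
  by rewrite euler_sqr; apply: eqXMr; apply: eqX_euler; lia.
apply: (eqX_trans (eqXMl _ (eqX_sym triple))).
have -> : P (4 * k) L = P k L ^+ 4.
  by rewrite (_ : (4 * k = 2 * (2 * k))%N) -?euler_sqr -?exprM //; lia.
rewrite mulrA [P (2 * k) _ * _]mulrC E.
have -> : P k L ^+ 2 * P k L ^+ 3 = P k L * P k L ^+ 4 by ring.
by apply: eqXMr; apply: eqX_euler; lia.
Qed.

(** The four arithmetic products cover the nonzero classes mod 5 and one P_5 covers the class 0,
    which makes P_1; the second P_5 remains. *)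
Lemma theta51_theta52 L M : (2 * M <= L)%N ->
  eqX M (theta _ 5 1 L * theta _ 5 2 L) (P 1 L * P 5 L).
Proof.
move=> ML.
have triple1 := @triple_product [the fieldType of 'F_2] 5 1 L M isT ML.
have triple2 := @triple_product [the fieldType of 'F_2] 5 2 L M isT ML.
apply: (eqX_trans (eqX_sym (eqXM triple1 triple2))).
have E : arith_prod _ 5 1 L * arith_prod _ 5 (5 - 1) L * (arith_prod _ 5 2 L *
    arith_prod _ 5 (5 - 2) L) * P 5 L = P 1 (5 * L).
  rewrite !euler_arith arith_prod_dissect !big_ord_recr big_ord0 /= mul1r.
  by rewrite ?muln1 ?mul1n; ring.
rewrite mulrACA mulrA E; apply: eqXMr; apply: eqX_euler; lia.
Qed.

Lemma euler1_euler5 N :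
  eqX N.+1 (P 1 N * P 5 N) (P 2 N ^+ 3 + 'X * P 10 N ^+ 3).
Proof.
(* Large enough for the lattice count (8 i + 2 <= L for i <= N) and for the triple product (2 (N +
   1) <= L). *)
pose L := (8 * N + 10)%N.
have eqNL k : (0 < k)%N -> eqX N.+1 (P k N) (P k L).
  by move=> k0; apply: eqX_euler => //; rewrite /L; lia.
apply: (eqX_trans (eqXM (eqNL 1%N isT) (eqNL 5 isT))).
apply: eqX_trans (eqXD (eqXX 3 (eqX_sym (eqNL 2 isT))) (eqXMl _ (eqXX 3 (eqX_sym (eqNL 10 isT))))).
have ML : (2 * N.+1 <= L)%N by rewrite /L; lia.
apply: (eqX_trans (eqX_sym (theta51_theta52 ML))).
have theta_sqr k : (0 < k)%N ->
    eqX N.+1 (theta _ (4 * k) k L * theta _ (4 * k) k L) (P (2 * k) L ^+ 3).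
  by move=> k0; rewrite -euler_sqr exprAC -expr2; apply: eqXX; apply: theta_euler3.
apply: eqX_trans (eqXD (theta_sqr 1%N isT) (eqXMl 'X (theta_sqr 5 isT))).
apply: eqX_coef => i iN.
have := @npts_theta i L ltac:(rewrite /L; lia).
move/(congr1 (fun n => n%:R : 'F_2)); rewrite natrD -!coef_theta_mul !expr0 !mul1r expr1.
(* The count puts the term q psi(q^5)^2 on the other side; in characteristic 2 it crosses without a
   sign. *)
by move=> E; rewrite coefD E -addrA -coefD addF2 coef0 addr0.
Qed.

(** * Reciprocals and dissections of eta quotients modulo 2 *)

Definition euler_inv (k N : nat) : {poly 'F_2} :=
  \prod_(1 <= j < N.+1) \sum_(i < N.+1) 'X^(k * j * i).

Local Notation I := euler_inv.

(** The geometric sum for each [j] telescopes to 1 - q^(k j (N+1)). *)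
Lemma euler_invK k N : (0 < k)%N -> eqX N.+1 (P k N * I k N) 1.
Proof.
move=> k0; rewrite /euler /euler_inv -big_split /=.
have E : \prod_(1 <= j < N.+1) 1 = 1 :> {poly 'F_2} by rewrite big1_eq.
rewrite -[X in eqX _ _ X]E {E} big_nat [X in eqX _ _ X]big_nat.
apply: eqX_prod => j /andP[j0 _].
have -> : \sum_(i < N.+1) 'X^(k * j * i) = \sum_(i < N.+1) ('X^(k * j)) ^+ i :> {poly 'F_2}.
  by apply: eq_bigr => i _; rewrite exprM.
rewrite -opprB mulNr -subrX1 opprB -exprM oppF2 -[X in eqX _ _ X]addr0.
by apply: eqXD; [exact: eqX_refl | apply: eqXn0; nia].
Qed.

Lemma euler_inv_sqr k N : I k N ^+ 2 = I (2 * k) N.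
Proof.
rewrite /euler_inv -prodrXl; apply: eq_bigr => j _.
rewrite -(pFrobenius_autE pchar2_polyF2) rmorph_sum; apply: eq_bigr => i _.
by rewrite [LHS]/= pFrobenius_autE -exprM; congr 'X^_; lia.
Qed.

(** Composition with ['X^d] makes visible that only exponents divisible by [d] occur. *)
Lemma euler_comp d k N : P (d * k) N = P k N \Po 'X^d.
Proof.
rewrite /euler rmorph_prod; apply: eq_bigr => j _.
by rewrite rmorphB rmorph1 /= comp_Xn_poly -exprM mulnA.
Qed.

Lemma euler_inv_comp d k N : I (d * k) N = I k N \Po 'X^d.
Proof.
rewrite /euler_inv rmorph_prod; apply: eq_bigr => j _.
rewrite rmorph_sum; apply: eq_bigr => i _ /=.
by rewrite comp_Xn_poly -exprM !mulnA.
Qed.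

(** Writing the even part as a composition lets [eta_quotient_cube] dissect it further. *)
Lemma eta_quotient_F10 N :
  eqX N.+1 (P 2 N * P 5 N ^+ 5 * I 1 N * I 10 N ^+ 5)
    ('X + ((P 1 N ^+ 3 * I 5 N ^+ 3) \Po 'X^2)).
Proof.
have PI k : (0 < k)%N -> eqX N.+1 (P k N * I k N) 1 by apply: euler_invK.
have -> : P 2 N * P 5 N ^+ 5 * I 1 N * I 10 N ^+ 5 =
    (P 1 N * I 1 N) * (P 10 N * I 10 N) ^+ 2 * ((P 1 N * P 5 N) * I 10 N ^+ 3).
  by rewrite -(euler_sqr 1) -(euler_sqr 5); ring.
apply: (eqX_trans (eqXMr _ (eqXM (PI 1%N isT) (eqXX 2 (PI 10 isT))))).
rewrite expr1n !mul1r; apply: (eqX_trans (eqXMr _ (euler1_euler5 N))).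
rewrite comp_polyM !rmorphXn /= -euler_comp -euler_inv_comp mulrDl addrC.
apply: eqXD (eqX_refl _ _); rewrite -mulrA -exprMn.
by rewrite -[X in eqX _ _ X]mulr1 -(expr1n _ 3); apply/eqXMl/eqXX/PI.
Qed.

(** The terms are P_8 / P_20, a series in q^4, and q P_2 P_10, with odd powers only; no exponent is
    2 mod 4. *)
Lemma eta_quotient_cube N :
  eqX N.+1 (P 1 N ^+ 3 * I 5 N ^+ 3)
    (((P 1 N ^+ 2 * I 5 N) \Po 'X^4) + 'X * ((P 1 N * P 5 N) \Po 'X^2)).
Proof.
have PI k : (0 < k)%N -> eqX N.+1 (P k N * I k N) 1 by apply: euler_invK.
(* Modulo 2, 1/P_5 = P_5/P_10; this brings out P_1 P_5 and leaves even series. *)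
have I5 : eqX N.+1 (I 5 N) (P 5 N * I 10 N).
  have -> : P 5 N * I 10 N = (P 5 N * I 5 N) * I 5 N.
    by rewrite -(euler_inv_sqr 5); ring.
  by rewrite -[X in eqX _ X _]mul1r; apply/eqXMr/eqX_sym/PI.
apply: (eqX_trans (eqXMl _ (eqXX 3 I5))).
have -> : P 1 N ^+ 3 * (P 5 N * I 10 N) ^+ 3
    = (P 1 N * P 5 N) * (P 2 N * P 10 N * I 10 N ^+ 3).
  by rewrite -(euler_sqr 1) -(euler_sqr 5); ring.
apply: (eqX_trans (eqXMr _ (euler1_euler5 N))).
rewrite !comp_polyM -!euler_comp -euler_inv_comp -[P (4 * 1) N](euler_sqr 2).
rewrite -[I (4 * 5) N](euler_inv_sqr 10).
have -> : (P 2 N ^+ 3 + 'X * P 10 N ^+ 3) * (P 2 N * P 10 N * I 10 N ^+ 3) =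
   (P 10 N * I 10 N) * (P 2 N ^+ 2 * P 2 N ^+ 2 * I 10 N ^+ 2) +
   (P 10 N * I 10 N) ^+ 3 * ('X * (P 2 N * P 10 N)) by ring.
apply: eqXD.
  by rewrite -[X in eqX _ _ X]mul1r; apply/eqXMr/PI.
rewrite -[X in eqX _ _ X]mul1r; apply: eqXMr.
by rewrite -[X in eqX _ _ X](expr1n _ 3); apply/eqXX/PI.
Qed.

Lemma coef_comp_Xn_eq0 (p : {poly 'F_2}) d i :
  (0 < d)%N -> ~~ (d %| i)%N -> (p \Po 'X^d)`_i = 0.
Proof. by move=> d0 /negPf di; rewrite coef_comp_poly_Xn // di. Qed.

Lemma coef_F10_odd N m : odd m -> (1 < m <= N)%N ->
  (P 2 N * P 5 N ^+ 5 * I 1 N * I 10 N ^+ 5)`_m = 0.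
Proof.
move=> m_odd /andP[m1 mN]; rewrite (coef_eqX (eta_quotient_F10 N)) // coefD coefX.
by rewrite coef_comp_Xn_eq0 ?dvdn2 ?negbK // gtn_eqF // addr0.
Qed.

Lemma coef_F10_4mod8 N m : (m %% 8 = 4)%N -> (m <= N)%N ->
  (P 2 N * P 5 N ^+ 5 * I 1 N * I 10 N ^+ 5)`_m = 0.
Proof.
move=> m4 mN; have mE : m = (m %/ 2 * 2)%N by lia.
rewrite (coef_eqX (eta_quotient_F10 N)) // coefD coefX gtn_eqF ?add0r; last by lia.
rewrite mE coef_comp_poly_Xn // dvdn_mull // mulnK //.
(* The index m / 2 is 2 mod 4, hence neither odd nor a multiple of 4. *)
rewrite (coef_eqX (eta_quotient_cube N)); last by lia.
by rewrite coefD coefXM !coef_comp_Xn_eq0 ?if_same ?addr0 //; lia.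
Qed.

(** * Reduction of the integer coefficients modulo 2 *)

Local Notation toF2 := (map_poly (intr : int -> 'F_2)).

Lemma map_poch_trunc k N : toF2 (poch_trunc k N) = P k N.
Proof.
rewrite /poch_trunc rmorph_prod; apply: eq_bigr => j _.
by rewrite rmorphB rmorph1 /= map_polyXn.
Qed.

Lemma map_poch_inv_trunc k N : toF2 (poch_inv_trunc k N) = I k N.
Proof.
rewrite /poch_inv_trunc rmorph_prod; apply: eq_bigr => j _.
by rewrite rmorph_sum; apply: eq_bigr => i _; rewrite /= map_polyXn.
Qed.

Lemma dvd2_intr_F2 (z : int) : (2 %| z)%Z = (z%:~R == 0 :> 'F_2).
Proof. by rewrite (dvdz_pcharf (pchar_Fp _)). Qed.

Lemma dvd2_coef (p : {poly int}) m : (2 %| p`_m)%Z = ((toF2 p)`_m == 0).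
Proof. by rewrite coef_map dvd2_intr_F2. Qed.

Theorem theorem4p5 :
  forall n : nat, (0 < n)%N ->
    ((2 %| J10 (2 * n))%Z /\ (2 %| J10 (8 * n + 3))%Z) /\
    (forall i : nat, (i <= 2)%N -> (2 %| J10star (4 * n + i))%Z).
Proof.
have F10 m : (2 %| F10_coef m)%Z =
    ((P 2 m * P 5 m ^+ 5 * I 1 m * I 10 m ^+ 5)`_m == 0).
  by rewrite dvd2_coef !(rmorphXn, rmorphM) /= !map_poch_trunc !map_poch_inv_trunc.
move=> n n0; split; first split.
(* [J10] reads [F10_coef] one place higher: 2 n becomes 2 n + 1 > 1, and 8 n + 3 becomes 8 n + 4. *)
- rewrite /J10 muln_eq0 !gtn_eqF // subr0 F10 coef_F10_odd //; lia.
- by rewrite /J10 addn_eq0 andbF subr0 F10 coef_F10_4mod8 //; lia.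
move=> i i2; rewrite /J10star; apply: rpredD; last by rewrite dvdz_mulr.
apply: rpredD; last by rewrite dvdz_mulr.
rewrite dvd2_coef rmorphXn !rmorphM /= !map_poch_trunc !map_poch_inv_trunc.
(* Modulo 2 a fourth power is a series in q^4, while [m] is 1, 2 or 3 mod 4. *)
set m := (4 * n + i).+1.
have P4 k : P k m ^+ 4 = P k m \Po 'X^4 by rewrite (exprM _ 2 2) !euler_sqr mulnA euler_comp.
have I4 k : I k m ^+ 4 = I k m \Po 'X^4.
  by rewrite (exprM _ 2 2) !euler_inv_sqr mulnA euler_inv_comp.
by rewrite !exprMn !P4 !I4 -!comp_polyM coef_comp_Xn_eq0 // /m; lia.
Qed.
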